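(* Let $G$ be a graph with independence number $\alpha(G)=2$ whose edges are colored with two colors. Then $G$ has a $(4,4)$-cover; that is, $V(G)$ can be covered by the vertex sets of two monochromatic subgraphs of $G$, each of diameter at most $4$. Equivalently, $f(2,2)\le 4$.
   Context: Graphs are finite and simple. A 2-colored graph is a graph in which each edge is assigned one of two colors. A monochromatic subgraph is a subgraph (not necessarily induced) all of whose edges have the same color; a single vertex counts as a monochromatic subgraph. The diameter of a graph $H$ is the smallest integer $d$ with $d_H(u,v)\le d$ for all $u,v\in V(H)$, where $d_H(u,v)$ is the length of a shortest path from $u$ to $v$ in $H$ itself ($\infty$ if there is none); a one-vertex graph has diameter $0$. A 2-colored graph $G$ has a $(p,q)$-cover if $V(G)$ is the union of the vertex sets of two monochromatic subgraphs of $G$, one of diameter at most $p$ and the other of diameter at most $q$; the two subgraphs may have the same or different colors and their vertex sets may overlap. $f(r,\alpha)$ denotes the least $d$ such that for every graph $G$ with $\alpha(G)=\alpha$ and every $r$-edge-coloring of $G$, $V(G)$ can be covered by the vertex sets of $(r-1)\alpha$ monochromatic connected subgraphs, each of diameter at most $d$. *)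

(* Defs.v *)
(* Mathematical Components; graphs are symmetric irreflexive relations on a
   finite type. *)
From mathcomp Require Import all_boot.

Set Implicit Arguments.
Unset Strict Implicit.
Unset Printing Implicit Defensive.

Record sgraph := SGraph {
  vertex :> finType;
  edge : rel vertex;
  edge_sym : symmetric edge;
  edge_irrefl : irreflexive edge }.

Definition independent (G : sgraph) (A : {set G}) : bool :=
  [forall x in A, forall y in A, ~~ edge x y].

Definition alpha (G : sgraph) : nat :=
  \max_(A : {set G} | independent A) #|A|.

(* Only the values of [color] on edges are ever used. *)
Record coloring (G : sgraph) (r : nat) := Coloring {
  color :> G -> G -> 'I_r;
  color_sym : forall x y : G, edge x y -> color x y = color y x }.

(* Subgraphs are nonempty and not necessarily induced. *)
Record subgraph (G : sgraph) := Subgraph {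
  svertex : {set G};
  sedge : rel G;
  svertex_neq0 : svertex != set0;
  sedge_sym : symmetric sedge;
  sedge_edge : forall x y : G, sedge x y -> edge x y;
  sedge_vertex : forall x y : G, sedge x y -> x \in svertex }.

Definition monochromatic (G : sgraph) (r : nat) (c : coloring G r)
    (H : subgraph G) : Prop :=
  exists k : 'I_r, forall x y : G, sedge H x y -> c x y = k.

Definition connected (G : sgraph) (H : subgraph G) : Prop :=
  forall u v : G, u \in svertex H -> v \in svertex H -> connect (sedge H) u v.

Definition is_least (P : nat -> Prop) (n : nat) : Prop :=
  P n /\ forall m : nat, P m -> n <= m.

Definition joined_by_path (G : sgraph) (H : subgraph G) (u v : G) (n : nat) :
    Prop :=
  exists p : seq G,
    [/\ path (sedge H) u p, uniq (u :: p), last u p = v & size p = n].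

(* Infinite distance is the absence of any [n] with [is_dist H u v n]. *)
Definition is_dist (G : sgraph) (H : subgraph G) (u v : G) (n : nat) : Prop :=
  is_least (joined_by_path H u v) n.

Definition dist_le (G : sgraph) (H : subgraph G) (u v : G) (d : nat) : Prop :=
  exists2 n : nat, is_dist H u v n & n <= d.

Definition is_diameter (G : sgraph) (H : subgraph G) (d : nat) : Prop :=
  is_least (fun d' : nat => forall u v : G,
    u \in svertex H -> v \in svertex H -> dist_le H u v d') d.

Definition diameter_le (G : sgraph) (H : subgraph G) (p : nat) : Prop :=
  exists2 d : nat, is_diameter H d & d <= p.

Definition has_cover (G : sgraph) (c : coloring G 2) (p q : nat) : Prop :=
  exists H1 H2 : subgraph G,
    [/\ monochromatic c H1, monochromatic c H2,
        diameter_le H1 p, diameter_le H2 q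
      & svertex H1 :|: svertex H2 = [set: G]].

Definition cover_bound (r a d : nat) : Prop :=
  forall (G : sgraph) (c : coloring G r), alpha G = a ->
  exists H : 'I_((r - 1) * a) -> subgraph G,
    (forall i, [/\ monochromatic c (H i), connected (H i)
                 & diameter_le (H i) d]) /\
    \bigcup_i svertex (H i) = [set: G].

(* [is_f r a d] says that f(r, a) is defined and equal to d. *)
Definition is_f (r a d : nat) : Prop := is_least (cover_bound r a) d.

(* Main.v *)
(** A ball of radius 2 in one color has diameter at most 4, and two such
    balls always suffice.  Otherwise pick
    [x], then [z] outside both balls of [x], then [w] outside the red balls of
    [x] and [z], and [w'] outside the blue ones.  As no three vertices are
    independent, up to symmetry [xw] is blue, [zw'] is red and
    [x, z, w, w'] is a 4-cycle of the complement.  A vertex [t] outside the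
    blue ball of [x] and the red ball of [z] cannot have two consecutive
    non-neighbors on this cycle, so it is adjacent to both [x] and [w] (both
    edges red, putting [w] in the red ball of [x]) or to both [z] and [w']
    (both blue, putting [w'] in the blue ball of [z]). *)

Require Import Defs.
From mathcomp Require Import all_boot.
From Stdlib Require Import Classical.

Set Implicit Arguments.
Unset Strict Implicit.
Unset Printing Implicit Defensive.

(** Classical descent for an arbitrary proposition [P]: it turns an upper bound on a distance, a
    diameter or f(2,2) into a least value within that bound. *)
Lemma least_exists (P : nat -> Prop) (n : nat) :
  P n -> exists2 m, is_least P m & m <= n.
Proof.
elim/ltn_ind: n => n IHn Pn.
case: (classic (exists2 m, P m & m < n)) => [[m Pm lt_mn]|minn].
  by have [k Pk le_km] := IHn m lt_mn Pm; exists k => //; apply: leq_trans le_km (ltnW lt_mn).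
exists n => //; split=> // m Pm; rewrite leqNgt.
by apply/negP => lt_mn; apply: minn; exists m.
Qed.

Definition ball2 (T : finType) (e : rel T) (x : T) : {set T} :=
  [set y | [|| x == y, e x y | [exists u, e x u && e u y]]].

Lemma notin_ball2 (T : finType) (e : rel T) (x y : T) : y \notin ball2 e x ->
  [/\ x != y, ~~ e x y & forall u, e x u -> ~~ e u y].
Proof.
rewrite inE !negb_or => /and3P[? ? /existsPn xy]; split=> // u xu.
by have := xy u; rewrite xu.
Qed.

Lemma ball2_sym (T : finType) (e : rel T) (x y : T) :
  symmetric e -> (y \in ball2 e x) = (x \in ball2 e y).
Proof.
move=> e_sym; rewrite !inE eq_sym e_sym; congr [|| _, _ | _].
by apply: eq_existsb => u; rewrite andbC e_sym [e u x]e_sym.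
Qed.

(** When [r] and [b] are the two color classes, its negation means distinct and nonadjacent, so the
    hypothesis [tri] below says that no three vertices are independent. *)
Definition near (T : finType) (r b : rel T) (x y : T) : bool :=
  [|| x == y, r x y | b x y].

Lemma cross_ball2_cover (T : finType) (r b : rel T) (x z w w' t : T) :
    symmetric r -> symmetric b ->
    (forall u v s, [|| near r b u v, near r b v s | near r b u s]) ->
    z \notin ball2 r x -> z \notin ball2 b x ->
    w \notin ball2 r x -> w \notin ball2 r z ->
    w' \notin ball2 b x -> w' \notin ball2 b z -> b x w ->
  (t \in ball2 b x) || (t \in ball2 r z).
Proof.
move=> r_sym b_sym tri.
case/notin_ball2=> xz rxz rxz2 /notin_ball2[_ bxz bxz2].
case/notin_ball2=> xw rxw rxw2 /notin_ball2[zw rzw rzw2].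
case/notin_ball2=> xw' bxw' bxw'2 /notin_ball2[zw' bzw' bzw'2] bxw.
have Nxz : ~~ near r b x z by rewrite /near !negb_or xz rxz.
(* A [b] edge [z w] would put [z] in the [b] ball of [x], through [w]. *)
have Nzw : ~~ near r b z w.
  by rewrite /near !negb_or zw rzw b_sym; apply: bxz2.
have ww' : w != w' by apply: contraNneq bxw' => <-.
have Nbww' : ~~ b w w' by apply: bxw'2.
(* The triple [x], [z], [w'] leaves [r x w'] or [r z w']. In the first case the triple [z], [w],
   [w'] still forces [r z w'], as [r w' w] would put [w] in the [r] ball of [x]. *)
have rzw' : r z w'.
  have := tri x z w'; rewrite (negPf Nxz) /= /near.
  rewrite (negPf xw') (negPf zw') (negPf bxw') (negPf bzw') /= !orbF.
  case/orP=> // rxw'; have := tri z w w'; rewrite (negPf Nzw) /= /near.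
  rewrite (negPf ww') (negPf zw') (negPf Nbww') (negPf bzw') /= !orbF.
  by rewrite r_sym (negPf (rxw2 _ rxw')).
have Nw'w : ~~ near r b w' w.
  by rewrite /near !negb_or eq_sym ww' rzw2 // b_sym.
have Nxw' : ~~ near r b x w'.
  rewrite /near !negb_or xw' bxw' andbT.
  by apply: contra rxz => rxw'; have := rxz2 _ rxw'; rewrite r_sym rzw'.
apply/negP => /negP; rewrite negb_or.
case/andP=> /notin_ball2[xt bxt bxt2] /notin_ball2[zt rzt rzt2].
(* By [b x w] and [r z w'], only [r] can join [t] to [x] or [w], and only [b] can join it to [z] or
   [w']. *)
have Nbwt : ~~ b w t by apply: bxt2.
have Nrw't : ~~ r w' t by apply: rzt2.
have tw : t != w by apply: contraNneq bxt => ->.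
have tw' : t != w' by apply: contraNneq rzt => ->.
have nxt : near r b x t = r x t by rewrite /near (negPf xt) (negPf bxt) orbF.
have nzt : near r b z t = b z t by rewrite /near (negPf zt) (negPf rzt).
have nwt : near r b w t = r t w.
  by rewrite /near eq_sym (negPf tw) (negPf Nbwt) orbF r_sym.
have nw't : near r b w' t = b t w'.
  by rewrite /near eq_sym (negPf tw') (negPf Nrw't) b_sym.
(* Each triple is [t] with one side of the complement cycle. The corners joined to [t] meet every
   side, hence include an opposite pair, which [rxw2] or [bzw'2] forbids. *)
have := tri x z t; have := tri w' w t; have := tri z w t; have := tri x w' t.
rewrite (negPf Nxz) (negPf Nw'w) (negPf Nzw) (negPf Nxw') nxt nzt nwt nw't /=.
have := rxw2 t; have := bzw'2 t.
by case: (r x t); case: (b z t); case: (r t w); case: (b t w') => //= A B;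
  do ?[by have := A isT | by have := B isT].
Qed.

Lemma two_ball2_cover (T : finType) (r b : rel T) (x : T) :
    symmetric r -> symmetric b ->
    (forall u v s, [|| near r b u v, near r b v s | near r b u s]) ->
  exists e1 e2 u v, [/\ e1 = r \/ e1 = b, e2 = r \/ e2 = b
                      & ball2 e1 u :|: ball2 e2 v = [set: T]].
Proof.
move=> r_sym b_sym tri.
have cover (A B : {set T}) : A :|: B = [set: T] \/
    exists2 t, t \notin A & t \notin B.
  have [->|] := eqVneq (A :|: B) [set: T]; first by left.
  rewrite -subTset => /subsetPn[t _]; rewrite inE negb_or => /andP[? ?].
  by right; exists t.
have [|[z zrx zbx]] := cover (ball2 r x) (ball2 b x).
  by exists r, b, x, x; split; auto.
have [|[w wrx wrz]] := cover (ball2 r x) (ball2 r z).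
  by exists r, r, x, z; split; auto.
have [|[w' wbx wbz]] := cover (ball2 b x) (ball2 b z).
  by exists b, b, x, z; split; auto.
have /or3P[xz|zw|xw] := tri x z w.
- have [] := (notin_ball2 zrx, notin_ball2 zbx) => -[/negPf xz' /negPf rxz _].
  by case=> _ /negPf bxz _; move: xz; rewrite /near xz' rxz bxz.
(* This case is the next one with [x] and [z] exchanged. *)
- exists b, r, z, x; split; auto; apply/setP=> t; rewrite in_setU in_setT.
  have [/negPf zw' /negPf rzw _] := notin_ball2 wrz.
  have bzw : b z w by move: zw; rewrite /near zw' rzw.
  by apply: (@cross_ball2_cover T r b z x w w' t); rewrite // ball2_sym.
- exists b, r, x, z; split; auto; apply/setP=> t; rewrite in_setU in_setT.
  have [/negPf xw' /negPf rxw _] := notin_ball2 wrx.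
  have bxw : b x w by move: xw; rewrite /near xw' rxw.
  exact: (@cross_ball2_cover T r b x z w w' t).
Qed.

(** Distances are defined by simple paths; shortening the walk lets walks be concatenated without
    checking for repeated vertices. *)
Lemma walk_dist_le (G : sgraph) (H : subgraph G) (u v : G) (p : seq G) (d : nat) :
  path (sedge H) u p -> last u p = v -> size p <= d -> dist_le H u v d.
Proof.
move=> up <- le_pd; case/shortenP: up => q uq uniq_q sub_qp.
have [|n n_least le_nq] := @least_exists (joined_by_path H u (last u q)) (size q).
  by exists q.
exists n => //; apply: leq_trans le_nq (leq_trans _ le_pd).
by apply: uniq_leq_size sub_qp; case/andP: uniq_q.
Qed.

Lemma diameter_leI (G : sgraph) (H : subgraph G) (d : nat) :
    (forall u v, u \in svertex H -> v \in svertex H -> dist_le H u v d) ->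
  diameter_le H d.
Proof. exact: least_exists. Qed.

Lemma diameter_le_connected (G : sgraph) (H : subgraph G) (d : nat) :
  diameter_le H d -> connected H.
Proof.
case=> d' [dH _] _ u v uH vH; have [n [[p [up _ <- _]] _] _] := dH u v uH vH.
by apply/connectP; exists p.
Qed.

Definition color_rel (G : sgraph) (c : coloring G 2) (k : 'I_2) : rel G :=
  fun x y => edge x y && (c x y == k).

Lemma color_rel_sym (G : sgraph) (c : coloring G 2) (k : 'I_2) :
  symmetric (color_rel c k).
Proof.
move=> x y; rewrite /color_rel edge_sym.
by have [/(color_sym c) ->|] := boolP (edge y x).
Qed.

(** The middle vertex of a path of length 2 from [x] is itself in the ball, so restricting to the
    ball keeps such paths; going through [x] joins any two vertices in 2 + 2 steps. *)
Lemma ball2_subgraph (G : sgraph) (c : coloring G 2) (k : 'I_2) (x : G) :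
  exists H : subgraph G,
    [/\ monochromatic c H, diameter_le H 4 & svertex H = ball2 (color_rel c k) x].
Proof.
set A := ball2 _ x; set e := color_rel c k.
have xA : x \in A by rewrite inE eqxx.
have A_neq0 : A != set0 by apply/set0Pn; exists x.
pose f := [rel u v | [&& e u v, u \in A & v \in A]].
have f_sym : symmetric f by move=> u v /=; rewrite /e color_rel_sym [(u \in A) && _]andbC.
have f_edge u v : f u v -> edge u v by case/andP=> /andP[].
have f_vertex u v : f u v -> u \in A by case/and3P.
exists (Subgraph A_neq0 f_sym f_edge f_vertex); split=> //.
  by exists k => u v /= /andP[/andP[_ /eqP]].
have walk u : u \in A ->
    exists p q, [/\ path f u p, last u p = x, size p <= 2,
                    path f x q & last x q = u /\ size q <= 2].
  move=> uA; have := uA; rewrite inE => /or3P[/eqP <-|xu|/existsP[v /andP[xv vu]]].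
  - by exists [::], [::].
  - have fxu : f x u by apply/and3P.
    by exists [:: x], [:: u]; split=> //; apply/andP; split=> //; rewrite f_sym.
  - have vA : v \in A by rewrite inE xv orbT.
    have fxv : f x v by apply/and3P.
    have fvu : f v u by apply/and3P.
    exists [:: v; x], [:: v; u]; split=> //; apply/and3P; split=> //.
      by rewrite f_sym.
    by rewrite f_sym.
apply: diameter_leI => u v /walk[p [_ [up px le_p2 _ _]]] /walk[_ [q [_ _ _ xq [qv le_q2]]]].
apply: (@walk_dist_le _ _ u v (p ++ q)).
- by rewrite cat_path up px.
- by rewrite last_cat px.
- by rewrite size_cat (leq_add le_p2 le_q2).
Qed.

Lemma alpha2_near (G : sgraph) (c : coloring G 2) (x y z : G) :
  alpha G = 2 ->
  [|| near (color_rel c ord0) (color_rel c ord_max) x y,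
      near (color_rel c ord0) (color_rel c ord_max) y z
    | near (color_rel c ord0) (color_rel c ord_max) x z].
Proof.
move=> alphaG; set nr := near _ _.
have Nnear u v : ~~ nr u v -> (u != v) && ~~ edge u v.
  rewrite /nr /near /color_rel; case: eqVneq => //= _.
  by case: edge => //=; case: (c u v) => [[|[|]]].
apply: contraT => /norP[/Nnear/andP[xy exy]].
case/norP=> /Nnear/andP[yz eyz] /Nnear/andP[xz exz].
have : #|[set x; y; z]| <= alpha G.
  apply: (@leq_bigmax_cond _ _ (fun A : {set G} => #|A|)).
  apply/forallP=> u; apply/implyP=> uA; apply/forallP=> v; apply/implyP.
  move: uA; rewrite !inE -!orbA => /or3P[] /eqP-> /or3P[] /eqP->;
    by rewrite ?edge_irrefl // edge_sym.
by rewrite alphaG setUC cardsU1 cards2 !inE !(eq_sym z) negb_or xy yz xz.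
Qed.

Lemma alpha2_has_cover (G : sgraph) (c : coloring G 2) :
  alpha G = 2 -> has_cover c 4 4.
Proof.
move=> alphaG.
(* The empty graph has independence number 0, so a first center exists. *)
have [x _] : exists x : G, true.
  apply: NNPP => noG; suff : alpha G <= 0 by rewrite alphaG.
  apply/bigmax_leqP => A _; rewrite leqn0 cards_eq0.
  by apply/negP => /negP/set0Pn[x _]; apply: noG; exists x.
have colors e : e = color_rel c ord0 \/ e = color_rel c ord_max ->
    exists k, e = color_rel c k by case=> ->; eexists.
have [_ [_ [u [v [/colors[k ->] /colors[l ->] uv]]]]] :=
  two_ball2_cover x (@color_rel_sym _ c ord0) (@color_rel_sym _ c ord_max)
    (fun x y z => alpha2_near c x y z alphaG).
have [H1 [mono1 diam1 vH1]] := ball2_subgraph c k u.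
have [H2 [mono2 diam2 vH2]] := ball2_subgraph c l v.
by exists H1, H2; split=> //; rewrite vH1 vH2.
Qed.

Lemma cover_bound_2_2_4 : cover_bound 2 2 4.
Proof.
move=> G c /(@alpha2_has_cover G c)[H1 [H2 [mono1 mono2 diam1 diam2 cov]]].
(* There are (2 - 1) * 2 = 2 indices, [ord0] and [ord_max]. *)
exists (fun i => if i == ord0 then H1 else H2); split.
  by move=> i; case: (i == ord0); split=> //; apply: diameter_le_connected; eassumption.
apply/setP=> x; rewrite in_setT; have := in_setT x; rewrite -cov => /setUP[xH|xH].
  by apply/bigcupP; exists ord0.
by apply/bigcupP; exists ord_max.
Qed.

Theorem theorem2p1 :
  (forall (G : sgraph) (c : coloring G 2), alpha G = 2 -> has_cover c 4 4) /\
  (exists2 d : nat, is_f 2 2 d & d <= 4).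
Proof.
split; first exact: alpha2_has_cover.
exact: least_exists cover_bound_2_2_4.
Qed.
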